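(* Let $(u^k)_{k\ge 0}$ be generated by the following thresholding iteration, starting from an arbitrary $u^0\in\mathcal B$: for each $k\ge 0$ set $$\varphi^k = G_\tau * \left(|d|^{\frac p2}(1-2u^k)\right),\qquad u^{k+1}(\mathbf x)=\begin{cases}1 & \text{if } \varphi^k(\mathbf x)\le 0,\\ 0 & \text{otherwise,}\end{cases}\qquad \mathbf x\in\Omega .$$ Then for all $k=1,2,\dots$, $$E^\tau(u^{k+1})\le E^\tau(u^k),$$ where $$E^\tau(u)=\sqrt{\frac{\pi}{\tau}}\int_{\mathbb R^n}|d|^{\frac p2}\,u\;G_\tau*\left(|d|^{\frac p2}(1-u)\right)\,d\mathbf x .$$
   Context: Let $n\ge 1$ be an integer, $p>0$ and $\tau>0$ real numbers, $\Omega\subset\mathbb R^n$ a bounded domain (the computational domain), and $\mathcal C\subset\mathbb R^n$ a nonempty finite set (the point cloud). Define $d(\mathbf x)=\min_{\mathbf y\in\mathcal C}|\mathbf x-\mathbf y|$ for $\mathbf x\in\mathbb R^n$. The heat kernel is $$G_\tau(\mathbf x)=\frac{1}{(4\pi\tau)^{n/2}}\exp\left(-\frac{|\mathbf x|^2}{4\tau}\right),$$ and $*$ denotes convolution on $\mathbb R^n$. The set $\mathcal B=\{u\in BV(\Omega,\mathbb R) : u(\mathbf x)\in\{0,1\}\}$ consists of the functions of bounded variation on $\Omega$ with values in $\{0,1\}$ (indicator functions). Functions on $\Omega$ are regarded as functions on $\mathbb R^n$ by extending them by $0$ outside $\Omega$ (so $1-u=1$ and $1-2u=1$ outside $\Omega$).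 *)

(* Defs.v *)
From HB Require Import structures.
From mathcomp Require Import all_boot all_order all_algebra.
From mathcomp Require Import all_classical all_reals all_analysis.

Set Implicit Arguments.
Unset Strict Implicit.
Unset Printing Implicit Defensive.

Import Order.TTheory GRing.Theory Num.Theory.
Import numFieldNormedType.Exports.

Local Open Scope classical_set_scope.
Local Open Scope ring_scope.

(* 'rV[R]_n carries the product sigma-algebra of n copies of the Borel
   sigma-algebra of R, i.e. the Borel sigma-algebra of R^n; this mirrors the
   library's instance on n.-tuple T. *)
Section measurable_rV.
Context {R : realType} {n : nat}.

Let coors : 'I_n -> 'rV[R]_n -> R := fun i x => x ord0 i.

Let rV_set0 : g_sigma_preimage coors set0.
Proof. exact: sigma_algebra0. Qed.

Let rV_setC A : g_sigma_preimage coors A -> g_sigma_preimage coors (~` A).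
Proof. exact: sigma_algebraC. Qed.

Let rV_bigcup (F : _^nat) : (forall i, g_sigma_preimage coors (F i)) ->
  g_sigma_preimage coors (\bigcup_i (F i)).
Proof. exact: sigma_algebra_bigcup. Qed.

HB.instance Definition _ := @isMeasurable.Build
  (measure_tuple_display default_measure_display)
  'rV[R]_n (g_sigma_preimage coors) rV_set0 rV_setC rV_bigcup.

End measurable_rV.

Lemma measurable_coord (R : realType) n (i : 'I_n) :
  measurable_fun [set: 'rV[R]_n] (fun x : 'rV[R]_n => x ord0 i).
Proof.
move=> _ Y mY; rewrite setTI; apply: sub_sigma_algebra => /=.
rewrite -bigcup_seq/=; exists i => /=; first by rewrite mem_index_enum.
by exists Y => //; rewrite setTI.
Qed.

Lemma measurable_fun_rVP d (T : measurableType d) (R : realType) n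
    (f : T -> 'rV[R]_n) :
  measurable_fun [set: T] f <->
  forall i, measurable_fun [set: T] (fun t => f t ord0 i : R).
Proof.
split=> [mf i|mf].
  by apply: (@measurableT_comp _ _ _ _ _ _ (fun x : 'rV[R]_n => x ord0 i)) => //;
    exact: measurable_coord.
move=> _ B mB; rewrite setTI.
suff : measurable `<=` [set A : set 'rV[R]_n | measurable (f @^-1` A)] by exact.
apply: smallest_sub => [|/=].
  split => /=.
  - by rewrite preimage_set0.
  - by move=> A mA; rewrite setTD preimage_setC; exact: measurableC.
  - by move=> F mF; rewrite preimage_bigcup; exact: bigcupT_measurable.
rewrite -bigcup_seq => A [i _ [Y mY <-]] /=.
by rewrite setTI; have := mf i measurableT _ mY; rewrite setTI.
Qed.

Lemma sigma_finite_product d1 d2 (T1 : measurableType d1)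
    (T2 : measurableType d2) (R : realType)
    (m1 : {sigma_finite_measure set T1 -> \bar R})
    (m2 : {sigma_finite_measure set T2 -> \bar R}) :
  sigma_finite setT (m1 \x m2)%E.
Proof.
have /sigma_finiteP[F [TF ndF Foo]] := sigma_finiteT m1.
have /sigma_finiteP[G [TG ndG Goo]] := sigma_finiteT m2.
exists (fun k => F k `*` G k).
  rewrite -setXTT TF TG; apply/seteqP; split=> [[x y]|[x y]].
    move=> [/= [i _ Fix] [j _ Gjy]]; exists (maxn i j) => //; split.
    - by move: x Fix; exact/subsetPset/ndF/leq_maxl.
    - by move: y Gjy; exact/subsetPset/ndG/leq_maxr.
  by move=> [i _ []/= ? ?]; split; exists i.
move=> k; have [mF Fk] := Foo k; have [mG Gk] := Goo k.
split; first exact: measurableX.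
by rewrite product_measure1E// lte_mul_pinfty// ge0_fin_numE.
Qed.

Section lebesgue_measure_rV.
Context {R : realType}.

Definition rV_cons n (z : measurableTypeR R * 'rV[R]_n) : 'rV[R]_n.+1 :=
  \row_i if unlift ord0 i is Some j then z.2 ord0 j else z.1.

Definition rV_uncons n (x : 'rV[R]_n.+1) : measurableTypeR R * 'rV[R]_n :=
  (x ord0 ord0, \row_i x ord0 (lift ord0 i)).

Lemma rV_cons0 n (z : measurableTypeR R * 'rV[R]_n) :
  rV_cons z ord0 ord0 = z.1.
Proof. by rewrite mxE unlift_none. Qed.

Lemma rV_consS n (z : measurableTypeR R * 'rV[R]_n) i :
  rV_cons z ord0 (lift ord0 i) = z.2 ord0 i.
Proof. by rewrite mxE liftK. Qed.

Lemma rV_consK n : cancel (@rV_cons n) (@rV_uncons n).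
Proof.
move=> z; rewrite /rV_uncons rV_cons0 [RHS]surjective_pairing; congr pair.
by apply/rowP => i; rewrite mxE rV_consS.
Qed.

Lemma measurable_rV_cons n : measurable_fun setT (@rV_cons n).
Proof.
apply/measurable_fun_rVP => i; case: (unliftP ord0 i) => [j|] ->.
- under eq_fun do rewrite rV_consS.
  apply: (@measurableT_comp _ _ _ _ _ _ (fun x : 'rV[R]_n => x ord0 j)) => //.
  exact: measurable_coord.
- under eq_fun do rewrite rV_cons0.
  exact: measurable_fst.
Qed.

Lemma measurable_rV_uncons n : measurable_fun setT (@rV_uncons n).
Proof.
apply/measurable_fun_pairP; split; first exact: measurable_coord.
apply/measurable_fun_rVP => i /=.
by under eq_fun do rewrite mxE; exact: measurable_coord.
Qed.

Section step.
Context n (mu : {sigma_finite_measure set 'rV[R]_n -> \bar R}).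

Definition leb_step : set 'rV[R]_n.+1 -> \bar R :=
  pushforward (@lebesgue_measure R \x mu)%E (@rV_cons n).

Let leb_step0 : leb_step set0 = 0%E.
Proof. by rewrite /leb_step /pushforward preimage_set0 measure0. Qed.

Let leb_step_ge0 A : (0 <= leb_step A)%E.
Proof. exact: (measure_ge0 (@lebesgue_measure R \x mu)%E). Qed.

Let leb_step_sigma_additive : semi_sigma_additive leb_step.
Proof.
move=> F mF tF mUF; rewrite /leb_step /pushforward preimage_bigcup.
have mpre A : measurable A -> measurable (@rV_cons n @^-1` A).
  by move=> mA; rewrite -[X in measurable X]setTI; exact: measurable_rV_cons.
apply: measure_semi_sigma_additive.
- by move=> k; exact: mpre.
- apply/trivIsetP => i j _ _ ij; rewrite -preimage_setI.
  by move/trivIsetP : tF => /(_ _ _ _ _ ij) ->//; rewrite preimage_set0.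
- by rewrite -preimage_bigcup; exact: mpre.
Qed.

HB.instance Definition _ := isMeasure.Build _ _ _ leb_step
  leb_step0 leb_step_ge0 leb_step_sigma_additive.

Let leb_step_sigma_finite : sigma_finite setT leb_step.
Proof.
have [F TF Foo] := sigma_finite_product (@lebesgue_measure R) mu.
exists (fun k => @rV_uncons n @^-1` F k).
  by rewrite -preimage_bigcup -TF preimage_setT.
move=> k; have [mF Fk] := Foo k; split.
  by rewrite -[X in measurable X]setTI; exact: measurable_rV_uncons.
rewrite /leb_step /pushforward -comp_preimage.
by rewrite (_ : _ \o _ = id) ?preimage_id//; apply/funext => z /=; rewrite rV_consK.
Qed.

HB.instance Definition _ := Measure_isSigmaFinite.Build _ _ _ leb_step
  leb_step_sigma_finite.

End step.

(* Lebesgue measure on R^n: the unit mass on R^0, and on R^n.+1 = R x R^n the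
   product of the one-dimensional Lebesgue measure with the one on R^n. *)
Fixpoint leb (n : nat) : {sigma_finite_measure set 'rV[R]_n -> \bar R} :=
  match n with
  | 0 => @dirac _ 'rV[R]_0 0 R
  | m.+1 => leb_step (leb m)
  end.

End lebesgue_measure_rV.
Arguments leb {R} n.

Lemma leb_box (R : realType) n (A : 'I_n -> set R) :
  (forall i, measurable (A i)) ->
  leb n [set x : 'rV[R]_n | forall i, A i (x ord0 i)] =
  (\prod_(i < n) (@lebesgue_measure R) (A i))%E.
Proof.
elim: n A => [|n IH] A mA.
  by rewrite big_ord0 /= diracE mem_set// => -[].
rewrite big_ord_recl -IH => [|i]; last exact: mA.
set B := [set x : 'rV[R]_n | _].
have mB : measurable B.
  rewrite (_ : B = \bigcap_(i in [set: 'I_n])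
     (fun x : 'rV[R]_n => x ord0 i) @^-1` A (lift ord0 i)).
    apply: fin_bigcap_measurable => // i _.
    by rewrite -[X in measurable X]setTI; exact: measurable_coord.
  by apply/seteqP; split => x /= h i; [move=> _|]; exact: h.
rewrite /= /leb_step /pushforward -product_measure1E//; last exact: (mA ord0).
congr (product_measure1 _ _ _); apply/seteqP; split => [[x y]|[x y]] /=.
  move=> h; split; first by have := h ord0; rewrite rV_cons0.
  by move=> i; have := h (lift ord0 i); rewrite rV_consS.
move=> [hx hy] i; case: (unliftP ord0 i) => [j|] ->.
- by rewrite rV_consS; exact: hy.
- by rewrite rV_cons0.
Qed.

Section thresholding.
Context {R : realType} {n : nat}.
Implicit Types (Omega C : set 'rV[R]_n) (u f g : 'rV[R]_n -> R)
  (phi : 'rV[R]_n -> 'rV[R]_n) (x y : 'rV[R]_n) (p tau : R).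

(* The library norm on 'rV[R]_n is the sup norm; the topology and the bounded
   sets are the same as for the Euclidean norm. *)
Definition enorm x : R := Num.sqrt (\sum_i x ord0 i ^+ 2).

Definition bounded_domain Omega : Prop :=
  [/\ open Omega, connected Omega, Omega !=set0 & bounded_set Omega].

(* An infimum in general; a minimum for finite nonempty C, see cloud_distP. *)
Definition cloud_dist C x : R := inf [set enorm (x - y) | y in C].

Lemma cloud_distP C x : finite_set C -> C !=set0 ->
  (exists2 y, C y & cloud_dist C x = enorm (x - y)) /\
  (forall y, C y -> cloud_dist C x <= enorm (x - y)).
Proof.
move=> finC [c Cc]; set D := [set enorm (x - y) | y in C].
have lbD : has_lbound D by exists 0 => _ [y _ <-]; exact: sqrtr_ge0.
have lb y : C y -> cloud_dist C x <= enorm (x - y).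
  by move=> Cy; apply: ge_inf => //; exists y.
split => //.
have /finite_seqP[s Cs] := finC.
have cs : (index c s < size s)%N by rewrite index_mem; move: Cc; rewrite Cs.
pose F (i : 'I_(size s)) := enorm (x - nth 0 s i).
have [i _ Fi] := @Order.TotalTheory.arg_minP _ _ _ (Ordinal cs) xpredT F isT.
have Ci : C (nth 0 s i) by rewrite Cs /= mem_nth.
exists (nth 0 s i) => //; apply/eqP; rewrite eq_le lb//=.
apply: lb_le_inf; first by exists (enorm (x - c)), c.
move=> _ [y + <-]; rewrite Cs /= => ys.
have ys' : (index y s < size s)%N by rewrite index_mem.
by have := Fi (Ordinal ys') isT; rewrite /F /= nth_index.
Qed.

Definition heat_kernel tau x : R :=
  ((4 * pi * tau) `^ (n%:R / 2))^-1 * expR (- (enorm x ^+ 2 / (4 * tau))).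

Definition convolution f g x : R := \int[leb n]_y (f (x - y) * g y).

Definition divergence phi x : R :=
  \sum_i ('D_(delta_mx ord0 i) phi x) ord0 i.

Definition C1c_field Omega phi : Prop :=
  [/\ forall i x, derivable phi x (delta_mx ord0 i),
      forall i, continuous (fun x => 'D_(delta_mx ord0 i) phi x),
      compact (closure [set x | phi x != 0]) &
      closure [set x | phi x != 0] `<=` Omega].

Definition rV_total_variation Omega u : \bar R :=
  ereal_sup [set (\int[leb n]_(x in Omega) (u x * divergence phi x)%:E)%E
            | phi in [set phi | C1c_field Omega phi /\
                                forall x, enorm (phi x) <= 1]].

Definition rV_bounded_variation Omega u : Prop :=
  (leb n).-integrable Omega (EFin \o u) /\ (rV_total_variation Omega u < +oo)%E.

(* Elements of BV are classes modulo null sets: u need not be Borel, only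
   almost everywhere equal on Omega to a Borel function v of bounded
   variation. The values of u outside Omega play no role. *)
Definition indicatorBV Omega u : Prop :=
  (exists2 v, rV_bounded_variation Omega v &
     {ae leb n, forall x, Omega x -> u x = v x}) /\
  (forall x, Omega x -> u x = 0 \/ u x = 1).

Definition weight C p x : R := `|cloud_dist C x| `^ (p / 2).

(* u \_ Omega is u extended by 0 outside Omega. *)
Definition phase Omega C p tau u : 'rV[R]_n -> R :=
  convolution (heat_kernel tau)
    (fun x => weight C p x * (1 - 2 * (u \_ Omega) x)).

Definition energy Omega C p tau u : R :=
  Num.sqrt (pi / tau) *
  \int[leb n]_x (weight C p x * (u \_ Omega) x *
    convolution (heat_kernel tau)
      (fun y => weight C p y * (1 - (u \_ Omega) y)) x).

End thresholding.

(* Main.v *)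
(* Let A be the symmetric bilinear form with kernel w(x) G(x - y) w(y), where
   w = |d|^(p/2). Up to a constant E(u) = A(u, 1 - u), hence
     E(v) - E(u) = A(v - u, 1 - 2u) - A(v - u, v - u).
   If v thresholds the phase of u, the first term has a nonpositive integrand.
   The second is nonnegative on boundedly supported functions: up to factors
   depending on x or on y alone, G(x - y) is exp(x.y / 2 tau), a power series
   with nonnegative coefficients in the kernel x.y. All integrals converge
   since w grows at most exponentially and G has Gaussian decay.
   The initial u is only a.e. equal to a Borel function, which does not change
   its phase, so that all later iterates are Borel. *)
Require Import Defs.
From mathcomp Require Import all_boot all_order all_algebra.
From mathcomp Require Import all_classical all_reals all_analysis.
Import Order.TTheory GRing.Theory Num.Theory.
Import numFieldNormedType.Exports.
Local Open Scope classical_set_scope.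
Local Open Scope ring_scope.
From mathcomp Require Import measurable_realfun ring lra.
Import HBNNSimple.
Set Implicit Arguments.
Unset Strict Implicit.
Unset Printing Implicit Defensive.

(** * Integrals of real-valued functions: monotonicity, null sets, domination *)

Section integrals.
Context {R : realType} {d : measure_display} {T : measurableType d}.
Variable mu : {measure set T -> \bar R}.

(** The integral of a nonnegative function is a supremum over the simple functions below it, and a
    larger function has more of them. *)
Lemma le_integral_nonmeasurable (f g : T -> \bar R) :
  (forall x, 0 <= f x)%E -> (forall x, f x <= g x)%E ->
  (\int[mu]_x f x <= \int[mu]_x g x)%E.
Proof.
move=> f0 fg.
have g0 x : (0 <= g x)%E by exact: le_trans (f0 x) (fg x).
rewrite !ge0_integralTE//.
by apply: ereal_sup_le => _ [h hf <-]; exists h => // x; exact: le_trans (hf x) (fg x).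
Qed.

(* [f] need not be measurable, unlike in the library's [ge0_ae_eq_integral]. *)
Lemma ge0_integral_ae_eq (f g : T -> \bar R) :
  (forall x, 0 <= f x)%E -> (forall x, 0 <= g x)%E ->
  measurable_fun setT g -> {ae mu, forall x, f x = g x} ->
  (\int[mu]_x f x = \int[mu]_x g x)%E.
Proof.
move=> f0 g0 mg fg; apply/eqP; rewrite eq_le; apply/andP; split.
  (* A simple function below [f] is almost everywhere below [g], so measurability is asked of [h]
     and [g] alone. *)
  rewrite [leLHS]ge0_integralTE//; apply: ge_ereal_sup => _ [h hf <-].
  rewrite -integralT_nnsfun; apply: ae_ge0_le_integral => //.
  - by move=> x _; rewrite lee_fin fun_ge0.
  - exact/measurable_EFinP.
  - by apply: filterS fg => x /= <- _; exact: hf.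
(* Conversely, cutting [g] to [0] on the null set [N] keeps its integral and puts it below [f]
   everywhere. *)
have [N [mN N0 fgN]] := fg.
rewrite (ge0_negligible_integral mN)// integral_mkcond.
apply: le_integral_nonmeasurable => x; rewrite patchE; case: ifPn => // /set_mem[_ Nx].
by rewrite -(_ : f x = g x)//; apply: contrapT => /fgN.
Qed.

(** This is what lets the phase of a non-Borel initial function be computed from a Borel
    representative. *)
Lemma Rintegral_ae_eq (f g : T -> R) :
  measurable_fun setT g -> {ae mu, forall x, f x = g x} ->
  \int[mu]_x f x = \int[mu]_x g x.
Proof.
move=> mg fg; have {}mg : measurable_fun setT (EFin \o g) by exact/measurable_EFinP.
rewrite /Rintegral [in LHS]integralE [in RHS]integralE; congr (fine (_ - _)%E).
- apply: ge0_integral_ae_eq => //; first exact: measurable_funepos.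
  by apply: filterS fg => x /= fgx; rewrite !funeposE/= fgx.
- apply: ge0_integral_ae_eq => //; first exact: measurable_funeneg.
  by apply: filterS fg => x /= fgx; rewrite !funenegE/= fgx.
Qed.

Lemma integrable_dominated (f P : T -> R) : measurable_fun setT f ->
  mu.-integrable setT (EFin \o P) -> (forall x, `|f x| <= P x) ->
  mu.-integrable setT (EFin \o f).
Proof.
move=> mf iP fP; apply: (le_integrable measurableT _ _ iP) => [|x _].
  exact/measurable_EFinP.
by rewrite /= lee_fin (le_trans (fP x))// ler_norm.
Qed.

Lemma integrable_measurable (f : T -> R) :
  mu.-integrable setT (EFin \o f) -> measurable_fun setT f.
Proof. by move=> /measurable_int/measurable_EFinP. Qed.

Lemma integrable_mulr_bounded (f h : T -> R) (B : R) :
  mu.-integrable setT (EFin \o f) -> measurable_fun setT h ->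
  (forall x, `|h x| <= B) -> mu.-integrable setT (EFin \o (f \* h)).
Proof.
move=> iF mh hB; have mf := integrable_measurable iF.
apply: (@integrable_dominated _ (fun x => B * `|f x|)).
- exact: measurable_funM.
- rewrite (_ : _ \o _ = fun x => B%:E * (`|f x|%:E))%E; last by apply/funext.
  by apply: integrableZl => //; exact: integrable_norm.
- by move=> x /=; rewrite normrM mulrC ler_wpM2r.
Qed.

Lemma Rintegral_sum (I : finType) (f : I -> T -> R) :
  (forall i, mu.-integrable setT (EFin \o f i)) ->
  \int[mu]_x (\sum_i f i x) = \sum_i \int[mu]_x f i x.
Proof.
move=> iF; rewrite /Rintegral; under eq_integral do rewrite -sumEFin.
rewrite integral_sum// -sum_fine// => i _.
exact: integrable_fin_num (iF i).
Qed.

End integrals.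

(** * Fubini for real-valued integrals over products *)

Lemma measurable_Rintegral2 (R : realType) d1 d2 (T1 : measurableType d1)
    (T2 : measurableType d2) (mu2 : {sigma_finite_measure set T2 -> \bar R})
    (f : T1 * T2 -> R) : measurable_fun setT f ->
  measurable_fun setT (fun x => \int[mu2]_y f (x, y)).
Proof.
move=> mf; apply: measurableT_comp => //.
(* Tonelli applies to the positive and negative parts separately; points where the inner integral is
   infinite do no harm, since [fine] is measurable. *)
rewrite (_ : (fun _ => _) = fun x =>
  (\int[mu2]_y (EFin \o f)^\+ (x, y) - \int[mu2]_y (EFin \o f)^\- (x, y))%E); last first.
  apply/funext => x; rewrite [LHS]integralE; congr (_ - _)%E.
  - by apply: eq_integral => y _; rewrite !funeposE.
  - by apply: eq_integral => y _; rewrite !funenegE.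
have mf' : measurable_fun setT (EFin \o f) by exact/measurable_EFinP.
apply: emeasurable_funB.
- by apply: measurable_fun_fubini_tonelli_F => //; exact: measurable_funepos.
- by apply: measurable_fun_fubini_tonelli_F => //; exact: measurable_funeneg.
Qed.

Section product.
Context {R : realType} {d1 d2 : measure_display}.
Context {T1 : measurableType d1} {T2 : measurableType d2}.
Variable mu1 : {sigma_finite_measure set T1 -> \bar R}.
Variable mu2 : {sigma_finite_measure set T2 -> \bar R}.

(** The inner real integral is [fine] of the extended one. The two agree wherever the section is
    integrable, hence almost everywhere, which suffices for the outer integral. *)
Lemma Rintegral12 (f : T1 * T2 -> R) :
  (mu1 \x mu2)%E.-integrable setT (EFin \o f) ->
  \int[(mu1 \x mu2)%E]_z f z = \int[mu1]_x \int[mu2]_y f (x, y).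
Proof.
move=> iF; congr fine; rewrite -(integral12_prod_meas1 iF).
apply: ae_eq_integral => //.
- exact: measurable_fubini_F iF.
- apply/measurable_EFinP/measurable_Rintegral2.
  exact: integrable_measurable iF.
- apply: filterS (ae_integrable1 iF) => x ix _.
  by rewrite /Rintegral fineK//; exact: integrable_fin_num ix.
Qed.

Lemma Rintegral21 (f : T1 * T2 -> R) :
  (mu1 \x mu2)%E.-integrable setT (EFin \o f) ->
  \int[(mu1 \x mu2)%E]_z f z = \int[mu2]_y \int[mu1]_x f (x, y).
Proof.
move=> iF; congr fine; rewrite -(integral21_prod_meas1 iF).
have mf := integrable_measurable iF.
apply: ae_eq_integral => //.
- exact: measurable_fubini_G iF.
- apply/measurable_EFinP.
  apply: (measurable_Rintegral2 mu1 (f := fun z => f (z.2, z.1))).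
  exact: measurableT_comp mf (@measurable_swap _ _ T2 T1).
- apply: filterS (ae_integrable2 iF) => x ix _.
  by rewrite /Rintegral fineK//; exact: integrable_fin_num ix.
Qed.

Lemma integrable_prod (f : T1 -> R) (g : T2 -> R) :
  mu1.-integrable setT (EFin \o f) -> mu2.-integrable setT (EFin \o g) ->
  (mu1 \x mu2)%E.-integrable setT (EFin \o (fun z => f z.1 * g z.2)).
Proof.
move=> iF iG.
have mf := integrable_measurable iF; have mg := integrable_measurable iG.
apply/integrable12ltyP.
  apply/measurable_EFinP; apply: measurable_funM.
  - exact: measurableT_comp mf measurable_fst.
  - exact: measurableT_comp mg measurable_snd.
under eq_integral => x _.
  under eq_integral do rewrite /= normrM EFinM.
  rewrite ge0_integralZl//; last by apply/measurable_EFinP; exact: measurableT_comp.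
  over.
rewrite /= ge0_integralZr//; [|by apply/measurable_EFinP; exact: measurableT_comp|]; last first.
  exact: integral_ge0.
have [_ iFoo] := integrableP _ _ _ iF; have [_ iGoo] := integrableP _ _ _ iG.
rewrite lte_mul_pinfty//; first exact: integral_ge0.
by rewrite ge0_fin_numE//; exact: integral_ge0.
Qed.

End product.

(** * Positive semidefiniteness of the exponential of a finite-rank kernel *)

Section positive_semidefinite.
Context {R : realType} {d : measure_display} {T : measurableType d}.
Variable mu : {sigma_finite_measure set T -> \bar R}.
Variables (n : nat) (e : 'I_n -> T -> R) (B : R).
Hypotheses (me : forall i, measurable_fun setT (e i))
  (eB : forall i x, `|e i x| <= B).

Let s (z : T * T) : R := \sum_i e i z.1 * e i z.2.

Let ms : measurable_fun setT s.
Proof.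
apply: measurable_sum => i; apply: measurable_funM.
- exact: measurableT_comp (me i) measurable_fst.
- exact: measurableT_comp (me i) measurable_snd.
Qed.

Let sB z : `|s z| <= B ^+ 2 *+ n.
Proof.
apply: le_trans (ler_norm_sum _ _ _) _.
rewrite -[in leRHS](card_ord n) -sumr_const; apply: ler_sum => i _.
by rewrite normrM expr2 ler_pM.
Qed.

Let integrable_form (h : T -> R) (g : T * T -> R) (M : R) :
  mu.-integrable setT (EFin \o h) ->
  measurable_fun setT g -> (forall z, `|g z| <= M) ->
  (mu \x mu)%E.-integrable setT (EFin \o (fun z => h z.1 * h z.2 * g z)).
Proof.
move=> ih mg gM.
exact: (integrable_mulr_bounded (integrable_prod ih ih) mg gM).
Qed.

(* One factor [\sum_i e i x * e i y] is absorbed by replacing [h] with the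
   [h * e i], and [s ^+ 0] gives [(\int h) ^+ 2]. *)
Lemma power_kernel_psd k (h : T -> R) : mu.-integrable setT (EFin \o h) ->
  0 <= \int[(mu \x mu)%E]_z (h z.1 * h z.2 * s z ^+ k).
Proof.
elim: k h => [|k IH] h ih.
  rewrite (_ : \int[_]_z _ = \int[(mu \x mu)%E]_z (h z.1 * h z.2)); last first.
    by apply: eq_Rintegral => z _; rewrite expr0 mulr1.
  rewrite Rintegral12/=; last exact: integrable_prod.
  under eq_Rintegral do rewrite RintegralZl//.
  by rewrite RintegralZr// -expr2 sqr_ge0.
have ihe i : mu.-integrable setT (EFin \o (h \* e i)).
  exact: (integrable_mulr_bounded ih (me i) (eB i)).
rewrite (_ : \int[_]_z _ = \int[(mu \x mu)%E]_z
   \sum_i ((h \* e i) z.1 * (h \* e i) z.2 * s z ^+ k)); last first.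
  apply: eq_Rintegral => z _; rewrite exprS mulrA {1}/s mulr_sumr mulr_suml.
  by apply: eq_bigr => i _ /=; ring.
have bk z : `|s z ^+ k| <= (B ^+ 2 *+ n) ^+ k.
  by rewrite normrX lerXn2r ?nnegrE ?normr_ge0// (le_trans _ (sB z)).
rewrite Rintegral_sum.
  by apply: sumr_ge0 => i _; exact: IH.
by move=> i; apply: integrable_form bk => //; exact: measurable_funX.
Qed.

(** The partial sums of the exponential series are nonnegative combinations of power kernels and are
    bounded by [expR (B ^+ 2 *+ n)], so dominated convergence passes the sign to the limit. *)
Lemma exp_kernel_psd (h : T -> R) : mu.-integrable setT (EFin \o h) ->
  0 <= \int[(mu \x mu)%E]_z (h z.1 * h z.2 * expR (s z)).
Proof.
move=> ih.
pose S N z : R := series (exp_coeff (s z)) N.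
have SE N z : S N z = \sum_(k < N) (k`!%:R)^-1 * s z ^+ k.
  rewrite /S /series/= big_mkord; apply: eq_bigr => k _.
  by rewrite /exp_coeff/= mulrC.
have mS N : measurable_fun setT (S N).
  rewrite (_ : S N = fun z => \sum_(k < N) (k`!%:R)^-1 * s z ^+ k); last first.
    by apply/funext => z; rewrite SE.
  apply: measurable_sum => k; apply: measurable_funM => //.
  exact: measurable_funX.
have SB N z : `|S N z| <= expR (B ^+ 2 *+ n).
  apply: (@le_trans _ _ (expR `|s z|)); last by rewrite ler_expR.
  apply: (@le_trans _ _ (series (exp_coeff `|s z|) N)).
    rewrite /S /series/=; apply: le_trans (ler_norm_sum _ _ _) _.
    by apply: ler_sum => k _; rewrite /exp_coeff/= normrM normrX normfV normr_nat.
  rewrite /expR; apply: nondecreasing_cvgn_le; last exact: is_cvg_series_exp_coeff.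
  apply/nondecreasing_seqP => m; rewrite /series/= big_nat_recr//= lerDl.
  exact: exp_coeff_ge0.
have pos N : 0 <= \int[(mu \x mu)%E]_z (h z.1 * h z.2 * S N z).
  rewrite (_ : \int[_]_z _ = \int[(mu \x mu)%E]_z
     \sum_(k < N) (h z.1 * h z.2 * ((k`!%:R)^-1 * s z ^+ k))); last first.
    by apply: eq_Rintegral => z _; rewrite SE mulr_sumr.
  have bk (k : nat) z : `|s z ^+ k| <= (B ^+ 2 *+ n) ^+ k.
    by rewrite normrX lerXn2r ?nnegrE ?normr_ge0// (le_trans _ (sB z)).
  have ik (k : nat) : (mu \x mu)%E.-integrable setT
      (EFin \o (fun z => h z.1 * h z.2 * s z ^+ k)).
    by apply: integrable_form (bk k) => //; exact: measurable_funX.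
  have kE (k : nat) : (fun z : T * T => h z.1 * h z.2 * ((k`!%:R)^-1 * s z ^+ k)) =
      (fun z => (k`!%:R)^-1 * (h z.1 * h z.2 * s z ^+ k)).
    by apply/funext => z; ring.
  rewrite Rintegral_sum => [|k].
    apply: sumr_ge0 => k _; rewrite kE RintegralZl//.
    by rewrite mulr_ge0//; exact: power_kernel_psd.
  rewrite kE (_ : _ \o _ = fun z => ((k`!%:R)^-1)%:E *
    (h z.1 * h z.2 * s z ^+ k)%:E)%E; last by apply/funext.
  by apply: integrableZl => //; exact: ik.
have iabs : (mu \x mu)%E.-integrable setT
    (EFin \o (fun z => h z.1 * h z.2 * expR (B ^+ 2 *+ n))).
  by apply: (integrable_form ih (M := expR (B ^+ 2 *+ n))) => // z; rewrite ger0_norm ?expR_ge0.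
have mhh : measurable_fun setT (fun z : T * T => h z.1 * h z.2).
  exact: integrable_measurable (integrable_prod ih ih).
have := @dominated_cvg _ _ _ (mu \x mu)%E setT measurableT
  (fun N z => (h z.1 * h z.2 * S N z)%:E) (fun z => (h z.1 * h z.2 * expR (s z))%:E)
  (fun z => `|(h z.1 * h z.2 * expR (B ^+ 2 *+ n))%:E|)%E.
move=> cv; apply: fine_ge0.
have {}cv : (\int[(mu \x mu)%E]_z (h z.1 * h z.2 * S N z)%:E)%E @[N --> \oo] -->
    (\int[(mu \x mu)%E]_z (h z.1 * h z.2 * expR (s z))%:E)%E.
  apply: cv => //.
  - by move=> N; apply/measurable_EFinP; exact: measurable_funM.
  - move=> z _; apply: cvg_EFin; first exact: nearW.
    by apply: cvgM; [exact: cvg_cst|exact: is_cvg_series_exp_coeff].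
  - exact: integrable_abse.
  - move=> N z _; rewrite lee_fin !normrM ler_wpM2l// ?mulr_ge0//.
    by rewrite [leRHS]ger0_norm ?expR_ge0.
rewrite -(cvg_lim _ cv)//; apply: lime_ge; first by apply/cvg_ex; eexists; exact: cv.
apply: nearW => N.
have iS : (mu \x mu)%E.-integrable setT (EFin \o (fun z => h z.1 * h z.2 * S N z)).
  exact: integrable_form (SB N).
by rewrite -[leRHS]fineK ?lee_fin ?pos//; exact: integrable_fin_num iS.
Qed.
End positive_semidefinite.

(** * Energy descent for an abstract symmetric kernel *)

Section threshold_energy.
Context {R : realType} {d : measure_display} {T : measurableType d}.
Variable mu : {sigma_finite_measure set T -> \bar R}.
Variables (D : set T) (w P : T -> R) (g : T * T -> R).
Hypotheses (mw : measurable_fun setT w) (mg : measurable_fun setT g)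
  (g_sym : forall x y, g (x, y) = g (y, x))
  (P_ge0 : forall x, 0 <= P x) (iP : mu.-integrable setT (EFin \o P))
  (wP : forall x, D x -> `|w x| <= P x)
  (gP : forall x y, D x -> `|g (x, y) * w y| <= P y).
Implicit Types a b u v : T -> R.

(** Integrand of the bilinear form [A(a, b)]. The first argument always vanishes off [D]: the
    majorant [P] controls [g (x, y) * w y] only for [x] in [D]. *)
Let F a b (z : T * T) : R := w z.1 * a z.1 * (g z * (w z.2 * b z.2)).

Let mF a b : measurable_fun setT a -> measurable_fun setT b ->
  measurable_fun setT (F a b).
Proof.
move=> ma mb; apply: measurable_funM.
  by apply: measurable_funM; apply: measurableT_comp => //; exact: measurable_fst.
apply: measurable_funM => //.
by apply: measurable_funM; apply: measurableT_comp => //; exact: measurable_snd.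
Qed.

Let gbP b x y : (forall x, `|b x| <= 1) -> D x -> `|g (x, y) * (w y * b y)| <= P y.
Proof.
move=> b1 Dx; rewrite mulrA normrM (le_trans _ (gP y Dx))//.
by rewrite ler_piMr.
Qed.

Let iF a b : measurable_fun setT a -> (forall x, `|a x| <= 1) ->
  (forall x, ~ D x -> a x = 0) ->
  measurable_fun setT b -> (forall x, `|b x| <= 1) ->
  (mu \x mu)%E.-integrable setT (EFin \o F a b).
Proof.
move=> ma a1 aD mb b1; apply: integrable_dominated (integrable_prod iP iP) _.
  exact: mF.
move=> [x y]; rewrite /F/=.
have [Dx|nDx] := pselect (D x); last by rewrite aD// mulr0 mul0r normr0 mulr_ge0.
rewrite normrM ler_pM//; last exact: gbP.
by rewrite normrM (le_trans _ (wP Dx))// ler_piMr.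
Qed.

Let FE a b : measurable_fun setT a -> (forall x, `|a x| <= 1) ->
  (forall x, ~ D x -> a x = 0) ->
  measurable_fun setT b -> (forall x, `|b x| <= 1) ->
  \int[(mu \x mu)%E]_z F a b z =
  \int[mu]_x (w x * a x * \int[mu]_y (g (x, y) * (w y * b y))).
Proof.
move=> ma a1 aD mb b1; rewrite Rintegral12; last exact: iF.
apply: eq_Rintegral => x _; rewrite /F/=.
have [Dx|nDx] := pselect (D x).
  rewrite RintegralZl//; apply: integrable_dominated iP _.
    apply: measurable_funM; last exact: measurable_funM.
    by apply: measurableT_comp => //; exact: pair1_measurable.
  by move=> y; exact: gbP.
rewrite aD// mulr0 mul0r; under eq_Rintegral do rewrite mul0r.
by rewrite Rintegral_cst// mul0r.
Qed.

(** The last two hypotheses carry the argument: the sign of the first variation at each [x], and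
    semidefiniteness tested on the single function [v - u]. *)
Lemma threshold_energy_le u v :
  measurable_fun setT u -> measurable_fun setT v ->
  (forall x, 0 <= u x <= 1) -> (forall x, 0 <= v x <= 1) ->
  (forall x, ~ D x -> u x = 0) -> (forall x, ~ D x -> v x = 0) ->
  (forall x, w x * (v x - u x) *
     \int[mu]_y (g (x, y) * (w y * (1 - 2 * u y))) <= 0) ->
  0 <= \int[(mu \x mu)%E]_z
    (w z.1 * (v z.1 - u z.1) * (g z * (w z.2 * (v z.2 - u z.2)))) ->
  \int[mu]_x (w x * v x * \int[mu]_y (g (x, y) * (w y * (1 - v y)))) <=
  \int[mu]_x (w x * u x * \int[mu]_y (g (x, y) * (w y * (1 - u y)))).
Proof.
move=> mu_ mv u01 v01 uD vD vu psd.
have abs1 a : (forall x, 0 <= a x <= 1) -> forall x, `|a x| <= 1.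
  by move=> a01 x; have /andP[a0 a1] := a01 x; rewrite ger0_norm.
have abs1C a : (forall x, 0 <= a x <= 1) -> forall x, `|1 - a x| <= 1.
  move=> a01 x; have /andP[a0 a1] := a01 x.
  by rewrite ger0_norm ?subr_ge0// gerBl.
have u1 := abs1 _ u01; have v1 := abs1 _ v01.
pose du x := v x - u x; pose cu x := 1 - 2 * u x.
have mdu : measurable_fun setT du by exact: measurable_funB.
have mcu : measurable_fun setT cu.
  by apply: measurable_funB => //; exact: measurable_funM.
have du1 x : `|du x| <= 1.
  have := u01 x; have := v01 x; rewrite /du ler_norml; lra.
have cu1 x : `|cu x| <= 1 by have := u01 x; rewrite /cu ler_norml; lra.
have duD x : ~ D x -> du x = 0 by move=> nDx; rewrite /du uD// vD// subrr.
have m1B a : measurable_fun setT a -> measurable_fun setT (fun x => 1 - a x).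
  by move=> ma; exact: measurable_funB.
rewrite -(FE mv v1 vD (m1B _ mv) (abs1C _ v01)).
rewrite -(FE mu_ u1 uD (m1B _ mu_) (abs1C _ u01)).
(* The sign appears only after integrating in [y]: the outer integrand is then nonpositive at each
   [x] by [vu]. *)
have first_variation : \int[(mu \x mu)%E]_z F du cu z <= 0.
  rewrite FE// fine_le0//; under eq_integral do rewrite -[X in X%:E]opprK EFinN.
  rewrite integral_ge0N => [|x _]; last by rewrite lee_fin oppr_ge0; exact: vu.
  by rewrite oppe_le0; apply: integral_ge0 => x _; rewrite lee_fin oppr_ge0; exact: vu.
have swap : \int[(mu \x mu)%E]_z F v u z = \int[(mu \x mu)%E]_z F u v z.
  rewrite Rintegral12 ?Rintegral21//; [|exact: iF..].
  apply: eq_Rintegral => x _; apply: eq_Rintegral => y _.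
  by rewrite /F/= g_sym; ring.
have iuu := iF mu_ u1 uD (m1B _ mu_) (abs1C _ u01).
have ivv := iF mv v1 vD (m1B _ mv) (abs1C _ v01).
have iuv := iF mu_ u1 uD mv v1.
have ivu := iF mv v1 vD mu_ u1.
have idc := iF mdu du1 duD mcu cu1.
have idd := iF mdu du1 duD mdu du1.
have iBl f f' : (mu \x mu)%E.-integrable setT (EFin \o f) ->
    (mu \x mu)%E.-integrable setT (EFin \o f') ->
    (mu \x mu)%E.-integrable setT (EFin \o (fun z : T * T => f z - f' z : R)).
  move=> i i'; rewrite (_ : _ \o _ = (EFin \o f) \- (EFin \o f'))%E; last first.
    by apply/funext.
  exact: integrableB.
(* The pointwise identity needs the correction [F v u - F u v], whose integral is zero by [swap]. *)
have : \int[(mu \x mu)%E]_z ((F v (fun x => 1 - v x) z - F u (fun x => 1 - u x) z) -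
     (F v u z - F u v z)) = \int[(mu \x mu)%E]_z (F du cu z - F du du z).
  by apply: eq_Rintegral => z _; rewrite /F /du /cu; ring.
rewrite !RintegralB//; [|exact: iBl..].
rewrite swap subrr subr0 => E.
rewrite -subr_le0 E subr_le0; exact: le_trans first_variation psd.
Qed.
End threshold_energy.

(** * Borel measurability of open sets, the distance and the kernel *)

Section rV_measurability.
Context {R : realType} {n : nat}.

Lemma measurable_rV_box (A : 'I_n -> set R) : (forall i, measurable (A i)) ->
  measurable [set x : 'rV[R]_n | forall i, A i (x ord0 i)].
Proof.
move=> mA; rewrite (_ : [set _ | _] = \bigcap_(i in [set: 'I_n])
     (fun x : 'rV[R]_n => x ord0 i) @^-1` A i).
  apply: fin_bigcap_measurable => // i _.
  by rewrite -[X in measurable X]setTI; exact: measurable_coord.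
by apply/seteqP; split => x /= h i; [move=> _|]; exact: h.
Qed.

(** The sigma-algebra is generated by the coordinates, so [U] is written as a countable union of the
    rational cubes of half-side [1/(m+1)] that it contains. *)
Lemma open_measurable_rV (U : set 'rV[R]_n) : open U -> measurable U.
Proof.
move=> oU.
pose box (q : 'rV[rat]_n) (m : nat) := [set y : 'rV[R]_n |
  forall i, `](ratr (q ord0 i) - m.+1%:R^-1), (ratr (q ord0 i) + m.+1%:R^-1)[%classic
    (y ord0 i)].
pose F (k : 'rV[rat]_n * nat) := if `[< box k.1 k.2 `<=` U >] then box k.1 k.2 else set0.
rewrite (_ : U = \bigcup_(k in [set: 'rV[rat]_n * nat]) F k).
  apply: countable_bigcupT_measurable => [|k]; first exact: countableP.
  rewrite /F; case: asboolP => // _; 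
  apply: (@measurable_rV_box (fun i => `](ratr (k.1 ord0 i) - k.2.+1%:R^-1),
    (ratr (k.1 ord0 i) + k.2.+1%:R^-1)[%classic)) => i.
  exact: measurable_itv.
apply/seteqP; split=> [x Ux|x [k _]]; last by rewrite /F; case: asboolP => // kU /kU.
have /nbhs_ballP[e/= e0 xeU] : nbhs x U by exact: open_nbhs_nbhs.
(* In each coordinate, [x] and any other point of the cube are within [1/(m+1)] of the centre, hence
   within [2/(m+1)] of each other. *)
have [m m2e] : exists m : nat, 2 * m.+1%:R^-1 < e.
  have : \forall m \near \oo, m.+1%:R^-1 < e / 2.
    have e20 : 0 < e / 2 by rewrite divr_gt0.
    exact: near_infty_natSinv_lt (PosNum e20).
  by move=> [m _ /(_ m (leqnn m)) h]; exists m; rewrite mulrC -ltr_pdivlMr.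
have : forall i, exists q : rat, ratr q \in `](x ord0 i - m.+1%:R^-1), (x ord0 i + m.+1%:R^-1)[.
  by move=> i; apply: rat_in_itvoo; rewrite ltrBlDr -addrA ltrDl; exact: addr_gt0.
move=> /choice[q qx].
exists (\row_i q i, m) => //; rewrite /F; case: asboolP => [_|]/=.
  move=> i /=; rewrite mxE; have := qx i; rewrite !in_itv/=.
  by move: (m.+1%:R^-1) (ratr _) (x ord0 i) => r a b; lra.
case=> y yb; apply: xeU; split=> // i j; rewrite (ord1 i) /ball/=.
have := yb j; have := qx j; rewrite /= mxE !in_itv/= ltr_norml.
by move: (m.+1%:R^-1) (ratr _) (x ord0 j) (y ord0 j) m2e => r a b c; lra.
Qed.

Lemma measurable_enorm d (T : measurableType d) (f : T -> 'rV[R]_n) :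
  measurable_fun setT f -> measurable_fun setT (fun t => enorm (f t)).
Proof.
move=> /measurable_fun_rVP mf.
rewrite (_ : (fun _ => _) = Num.sqrt \o (fun t => \sum_i f t ord0 i ^+ 2))//.
apply: measurableT_comp.
  by apply: continuous_measurable_fun; exact: sqrt_continuous.
by apply: measurable_sum => i; exact: measurable_funX.
Qed.

(** For a minimum over finitely many points, the preimage of [[r, +oo)] is a finite intersection. *)
Lemma measurable_cloud_dist (C : set 'rV[R]_n) : finite_set C -> C !=set0 ->
  measurable_fun setT (cloud_dist C).
Proof.
move=> fC C0; apply: (measurability (@RGenCInfty.G R)).
  exact: RGenCInfty.measurableE.
move=> _ [_ [r ->] <-]; rewrite setTI.
rewrite (_ : _ @^-1` _ = \bigcap_(y in C) [set x | r <= enorm (x - y)]).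
  apply: fin_bigcap_measurable => // y _.
  rewrite -[X in measurable X]setTI (_ : [set x | _] =
    (fun x => enorm (x - y)) @^-1` `[r, +oo[%classic).
    apply: measurable_enorm => //; apply/measurable_fun_rVP => i.
    under eq_fun do rewrite mxE.
    by apply: measurable_funD => //; exact: measurable_coord.
  by apply/seteqP; split => x /=; rewrite in_itv/= andbT.
apply/seteqP; split => x /=; rewrite in_itv/= andbT.
  by move=> rx y Cy; apply: le_trans rx _; exact: (cloud_distP x fC C0).2.
by move=> rx; have [[y Cy ->] _] := cloud_distP x fC C0; exact: rx.
Qed.

Lemma measurable_weight (C : set 'rV[R]_n) p : finite_set C -> C !=set0 ->
  measurable_fun setT (weight C p).
Proof.
move=> fC C0; apply: (measurableT_comp (measurable_powR _)).
by apply: measurableT_comp => //; exact: measurable_cloud_dist.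
Qed.

Lemma measurable_heat_kernelB tau :
  measurable_fun setT (fun z : 'rV[R]_n * 'rV[R]_n => heat_kernel tau (z.1 - z.2)).
Proof.
apply: measurable_funM => //; apply: measurableT_comp => //.
apply: measurableT_comp => //; apply: measurable_funM => //.
apply: measurable_funX; apply: measurable_enorm; apply/measurable_fun_rVP => i.
under eq_fun do rewrite !mxE.
apply: measurable_funB.
- exact: measurableT_comp (measurable_coord i) measurable_fst.
- exact: measurableT_comp (measurable_coord i) measurable_snd.
Qed.

End rV_measurability.

(** * Integrability of Gaussians *)

Section gaussian.
Context {R : realType}.

Lemma integrable_gaussian (a : R) : 0 < a ->
  (@lebesgue_measure R).-integrable setT (EFin \o (fun t => expR (- (a * t ^+ 2)))).
Proof.
(* With variance [1/(2a)] the centred normal density is this function times [normal_peak s]. *)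
move=> a0; pose s : R := Num.sqrt (2 * a)^-1.
have s0 : s != 0 by rewrite gt_eqF// sqrtr_gt0 invr_gt0 mulr_gt0.
have := integrableZl measurableT (normal_peak s)^-1 (integrable_normal_pdf 0 s).
rewrite (_ : (fun _ => _) = EFin \o (fun t => expR (- (a * t ^+ 2))))//.
apply/funext => t; rewrite /normal_pdf (negbTE s0)/= -EFinM; congr EFin.
rewrite mulKf ?gt_eqF ?normal_peak_gt0// /normal_fun subr0; congr expR.
rewrite sqr_sqrtr; last by rewrite invr_ge0 mulr_ge0// ltW.
by field; rewrite gt_eqF.
Qed.

Definition gaussian (a : R) n (x : 'rV[R]_n) : R :=
  expR (- (a * \sum_i x ord0 i ^+ 2)).

Lemma measurable_gaussian a n : measurable_fun setT (@gaussian a n).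
Proof.
apply: measurableT_comp => //; apply: measurableT_comp => //.
apply: measurable_funM => //; apply: measurable_sum => i; apply: measurable_funX.
exact: measurable_coord.
Qed.

(** The induction follows [leb]: the Gaussian splits into its first coordinate and the rest, and
    [rV_cons] pushes the product measure to [leb n.+1]. *)
Lemma integrable_gaussian_rV (a : R) n : 0 < a ->
  (leb n).-integrable setT (EFin \o @gaussian a n).
Proof.
move=> a0; elim: n => [|n IH].
  apply/integrableP; split; first by apply/measurable_EFinP; exact: measurable_gaussian.
  rewrite /= integral_dirac//= ?diracT ?mul1e ?ltry//.
  apply/measurable_EFinP; apply: measurableT_comp => //; exact: measurable_gaussian.
apply: (integrable_pushforward (@measurable_rV_cons R n)) => //.
  by apply/measurable_EFinP; exact: measurable_gaussian.
rewrite preimage_setT.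
have := integrable_prod (integrable_gaussian a0) IH.
rewrite (_ : _ \o _ = (EFin \o @gaussian a n.+1) \o @rV_cons R n)//.
apply/funext => z /=; congr EFin; rewrite /gaussian -expRD; congr expR.
rewrite big_ord_recl rV_cons0 mulrDr opprD; congr (_ - _ * _).
by apply: eq_bigr => i _; rewrite rV_consS.
Qed.
End gaussian.

(** * Growth of the weight against decay of the heat kernel *)

Section bounds.
Context {R : realType} {n : nat}.
Implicit Types (x y c : 'rV[R]_n) (C : set 'rV[R]_n) (p tau : R).

Lemma enorm_le_sum x : enorm x <= \sum_i `|x ord0 i|.
Proof.
rewrite -(ler_pXn2r (n := 2))// ?nnegrE ?sqrtr_ge0 ?sumr_ge0//.
rewrite sqr_sqrtr; last by apply: sumr_ge0 => i _; exact: sqr_ge0.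
rewrite expr2 mulr_suml; apply: ler_sum => i _.
rewrite -real_normK ?num_real// expr2 ler_wpM2l//.
by rewrite (bigD1 i)//= lerDl sumr_ge0.
Qed.

(** From [ln d <= d] one gets [d^q <= exp (q d)] with [q = p/2]; bounding [d] by a sum over
    coordinates makes the bound a product of one-dimensional factors. *)
Lemma weight_le C c p x : finite_set C -> C c -> 0 < p ->
  weight C p x <= expR (\sum_i (p / 2 * (`|x ord0 i| + `|c ord0 i|))).
Proof.
move=> fC Cc p0; have C0 : C !=set0 by exists c.
have q0 : 0 < p / 2 by rewrite divr_gt0.
have d0 : 0 <= cloud_dist C x.
  by have [[y _ ->] _] := cloud_distP x fC C0; exact: sqrtr_ge0.
rewrite /weight ger0_norm//; apply: (@le_trans _ _ (expR (p / 2 * cloud_dist C x))).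
  (* At base [0] the power is [0] by convention, the exponent being nonzero, so points of the cloud
     are treated apart. *)
  rewrite /powR; case: ifPn => [/eqP ->|dN0].
    by rewrite gt_eqF// mulr0 expR0.
  by rewrite ler_expR ler_pM2l// ltW// ln_sublinear// lt_neqAle eq_sym dN0.
rewrite ler_expR -mulr_sumr ler_pM2l//.
apply: (le_trans ((cloud_distP x fC C0).2 c Cc)); apply: le_trans (enorm_le_sum _) _.
by apply: ler_sum => i _; rewrite !mxE ler_normB.
Qed.

Lemma enorm2 x : enorm x ^+ 2 = \sum_i x ord0 i ^+ 2.
Proof. by rewrite sqr_sqrtr//; apply: sumr_ge0 => i _; exact: sqr_ge0. Qed.

(** Gaussian decay absorbs the exponential growth of the weight. A quarter of the rate [1/(4 tau)]
    survives, uniformly for [x] in the box. *)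
Lemma heat_kernel_weight_le C c p tau (B : R) : finite_set C -> C c -> 0 < p -> 0 < tau ->
  exists M : R, forall x y, (forall i, `|x ord0 i| <= B) ->
    heat_kernel tau (x - y) * weight C p y <= M * gaussian ((16 * tau)^-1) y.
Proof.
move=> fC Cc p0 tau0; set q := p / 2; pose K : R := ((4 * pi * tau) `^ (n%:R / 2))^-1.
have K0 : 0 <= K by rewrite invr_ge0 powR_ge0.
(* Per coordinate, with [a], [t] those of [x], [y]: [q|t| <= t^2/(16 tau) + 4 tau q^2], and [-(a -
   t)^2/(4 tau) <= a^2/(4 tau) - t^2/(8 tau)] with [a^2 <= B^2]. *)
exists (K * expR (\sum_(i < n) (4 * tau * q ^+ 2 + B ^+ 2 / (4 * tau) + q * `|c ord0 i|))).
move=> x y xB; rewrite /heat_kernel -/K -[leLHS]mulrA -[leRHS]mulrA ler_wpM2l//.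
apply: (le_trans (ler_wpM2l (expR_ge0 _) (weight_le y fC Cc p0))).
rewrite /gaussian -!expRD ler_expR enorm2 mulr_suml mulr_sumr -!sumrN -!big_split/=.
apply: ler_sum => i _; rewrite !mxE.
move: (xB i) (normr_ge0 (c ord0 i)); rewrite -/q.
move: (x _ _) (c _ _) (y _ _) => a b t aB _.
have tE : t ^+ 2 = `|t| ^+ 2 by rewrite real_normK ?num_real.
have aB2 : a ^+ 2 <= B ^+ 2.
  by rewrite -real_normK ?num_real// lerXn2r ?nnegrE ?(le_trans _ aB).
(* These two inequalities as a sum of squares. The last summand is zero; it is kept because [field]
   does not relate [|t|] to [t]. *)
rewrite -subr_ge0 (_ : _ - _ = (16 * tau)^-1 * ((`|t| - 8 * tau * q) ^+ 2 +
    2 * (2 * a - t) ^+ 2 + 4 * (B ^+ 2 - a ^+ 2) + (t ^+ 2 - `|t| ^+ 2))).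
  rewrite tE subrr addr0; apply: mulr_ge0; first by rewrite invr_ge0 mulr_ge0// ltW.
  apply: addr_ge0; last by rewrite mulr_ge0// subr_ge0.
  by apply: addr_ge0; [|apply: mulr_ge0 => //]; exact: sqr_ge0.
by field; rewrite gt_eqF.
Qed.
End bounds.

Lemma bounded_set_coord (R : realType) n (D : set 'rV[R]_n) : bounded_set D ->
  exists2 B : R, 0 <= B & forall x, D x -> forall i, `|x ord0 i| <= B.
Proof.
move=> [M [_ DM]]; exists (`|M| + 1); first by rewrite addr_ge0.
move=> x Dx i; apply: (@le_trans _ _ `|x|).
  rewrite [leRHS]mx_normrE.
  exact: (le_bigmax _ (fun ij => `|x ij.1 ij.2|) (ord0, i)).
by apply: DM Dx; rewrite (le_lt_trans (ler_norm M))// ltrDl.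
Qed.

(** * Bounds and semidefiniteness on a bounded set *)

Section bounded_support.
Context {R : realType} {n : nat}.
Variables (D : set 'rV[R]_n) (B : R).
Hypotheses (mD : measurable D) (B0 : 0 <= B)
  (DB : forall x, D x -> forall i, `|x ord0 i| <= B).

(** A Gaussian is bounded below on the bounded set [D], so the one that dominates the kernel can
    dominate the weight there too. *)
Lemma weight_le_gaussian (C : set 'rV[R]_n) c p a :
  finite_set C -> C c -> 0 < p -> 0 <= a ->
  exists M : R, forall x, D x -> weight C p x <= M * gaussian a x.
Proof.
move=> fC Cc p0 a0.
exists (expR (\sum_(i < n) (p / 2 * (B + `|c ord0 i|) + a * B ^+ 2))) => x Dx.
apply: (le_trans (weight_le x fC Cc p0)).
rewrite /gaussian -expRD ler_expR mulr_sumr -sumrN -big_split/=.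
apply: ler_sum => i _; rewrite -addrA -mulrBr ler_wpDr//; last first.
  by rewrite ler_wpM2l ?divr_ge0 ?(ltW p0)// lerD2r DB.
rewrite mulr_ge0// subr_ge0 -[leLHS]real_normK ?num_real// lerXn2r ?nnegrE//.
exact: DB.
Qed.

(* [|x - y|^2 = |x|^2 + |y|^2 - 2 x.y] reduces the heat kernel to [expR] of a
   finite-rank kernel, so no Gaussian semigroup identity is needed. *)
Lemma heat_kernel_psd tau (f : 'rV[R]_n -> R) : 0 < tau ->
  (leb n).-integrable setT (EFin \o f) -> (forall x, ~ D x -> f x = 0) ->
  0 <= \int[(leb n \x leb n)%E]_z (f z.1 * (heat_kernel tau (z.1 - z.2) * f z.2)).
Proof.
move=> tau0 i_f f0.
pose K : R := ((4 * pi * tau) `^ (n%:R / 2))^-1.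
have K0 : 0 <= K by rewrite invr_ge0 powR_ge0.
(* Each variable takes its factor [exp (-|x|^2 / (4 tau))] and a square root of the normalization
   [K]. *)
pose h x := f x * (Num.sqrt K * gaussian (4 * tau)^-1 x).
(* Scaled so that the sum of products is [x.y / (2 tau)] on [D]; cut off outside [D] to be bounded,
   which is harmless because [f] vanishes there. *)
pose e i := (fun x : 'rV[R]_n => (Num.sqrt (2 * tau))^-1 * x ord0 i) \_ D.
have me i : measurable_fun setT (e i).
  apply/(measurable_restrictT _ mD); apply: measurable_funTS.
  by apply: measurable_funM => //; exact: measurable_coord.
have eB i x : `|e i x| <= (Num.sqrt (2 * tau))^-1 * B.
  rewrite /e patchE; case: ifPn => [/set_mem Dx|_].
    by rewrite normrM ger0_norm ?invr_ge0 ?sqrtr_ge0// ler_wpM2l ?invr_ge0 ?sqrtr_ge0// DB.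
  by rewrite normr0 mulr_ge0// invr_ge0 sqrtr_ge0.
have ih : (leb n).-integrable setT (EFin \o h).
  apply: (integrable_mulr_bounded i_f (B := Num.sqrt K)).
    by apply: measurable_funM => //; exact: measurable_gaussian.
  move=> x; rewrite normrM ger0_norm ?sqrtr_ge0// ler_piMr ?sqrtr_ge0//.
  rewrite /gaussian ger0_norm ?expR_ge0// -[leRHS]expR0 ler_expR oppr_le0.
  apply: mulr_ge0; first by rewrite invr_ge0 mulr_ge0// ltW.
  by apply: sumr_ge0 => i _; exact: sqr_ge0.
have := exp_kernel_psd me eB ih; congr (0 <= _).
apply: eq_Rintegral => -[x y] _ /=.
have [Dx|nDx] := pselect (D x); last by rewrite /h f0// !mul0r.
have [Dy|nDy] := pselect (D y); last by rewrite /h (f0 y)// !(mul0r, mulr0).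
rewrite (_ : \sum_i _ = (2 * tau)^-1 * \sum_i x ord0 i * y ord0 i); last first.
  rewrite mulr_sumr; apply: eq_bigr => i _; rewrite /e !patchE !mem_set//.
  rewrite mulrACA -invfM -expr2 sqr_sqrtr//; by rewrite mulr_ge0// ltW.
rewrite /h /heat_kernel -/K.
rewrite (_ : _ * _ * _ = f x * f y * (Num.sqrt K ^+ 2 * (gaussian (4 * tau)^-1 x *
  gaussian (4 * tau)^-1 y * expR ((2 * tau)^-1 * \sum_i x ord0 i * y ord0 i)))); last by ring.
rewrite sqr_sqrtr// [RHS](_ : _ = f x * f y * (K * expR (- (enorm (x - y) ^+ 2 / (4 * tau))))).
  congr (_ * (_ * _)).
  rewrite /gaussian -!expRD enorm2; congr expR.
  rewrite (_ : \sum_i (x - y) ord0 i ^+ 2 = \sum_i x ord0 i ^+ 2 + \sum_i y ord0 i ^+ 2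
     - 2 * \sum_i x ord0 i * y ord0 i); last first.
    rewrite mulr_sumr -sumrN -!big_split/=; apply: eq_bigr => i _; rewrite !mxE; ring.
  by field; rewrite gt_eqF.
by ring.
Qed.

End bounded_support.

(** * The thresholding step for the heat kernel *)

Section thresholding.
Context {R : realType} {n : nat}.
Variables (p tau : R) (Omega C : set 'rV[R]_n).
Hypotheses (p0 : 0 < p) (tau0 : 0 < tau) (bOmega : bounded_domain Omega)
  (fC : finite_set C) (C0 : C !=set0).
Implicit Types u v : 'rV[R]_n -> R.

Let mOmega : measurable Omega.
Proof. by have [oO _ _ _] := bOmega; exact: open_measurable_rV. Qed.

Let mw : measurable_fun setT (weight C p). Proof. exact: measurable_weight. Qed.

Let mG := @measurable_heat_kernelB R n tau.

Lemma heat_kernel_sym (x y : 'rV[R]_n) : heat_kernel tau (x - y) = heat_kernel tau (y - x).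
Proof.
rewrite /heat_kernel (_ : enorm (x - y) ^+ 2 = enorm (y - x) ^+ 2)// !enorm2.
by apply: eq_bigr => i _; rewrite !mxE -sqrrN opprB.
Qed.

(** A null-set change of [u] leaves the phase the same at every point, so it may be computed with
    the Borel function [v]. *)
Lemma measurable_phase u v : measurable_fun setT v ->
  {ae leb n, forall x, (u \_ Omega) x = v x} ->
  measurable_fun setT (phase Omega C p tau u).
Proof.
move=> mv uv.
have mF : measurable_fun setT (fun z : 'rV[R]_n * 'rV[R]_n =>
    heat_kernel tau (z.1 - z.2) * (weight C p z.2 * (1 - 2 * v z.2))).
  apply: measurable_funM => //.
  apply: (measurableT_comp (f := fun y => weight C p y * (1 - 2 * v y))) measurable_snd.
  by apply: measurable_funM => //; apply: measurable_funB => //; exact: measurable_funM.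
have := measurable_Rintegral2 (leb n) mF; congr measurable_fun.
apply/funext => x; apply/esym/Rintegral_ae_eq.
  exact: measurableT_comp mF (pair1_measurable x).
by apply: filterS uv => y ->.
Qed.

(** Extended by [0], since the iteration prescribes the next iterate on [Omega] only and [phase] and
    [energy] see just this extension. *)
Definition threshold u : 'rV[R]_n -> R :=
  (fun x => if phase Omega C p tau u x <= 0 then 1 else 0 : R) \_ Omega.

Lemma measurable_threshold u v : measurable_fun setT v ->
  {ae leb n, forall x, (u \_ Omega) x = v x} ->
  measurable_fun setT (threshold u).
Proof.
move=> mv uv; apply/(measurable_restrictT _ mOmega); apply: measurable_funTS.
apply: measurable_fun_ifT => //; apply: measurable_fun_ler => //.
exact: measurable_phase uv.
Qed.

Lemma indicatorBV_ae_measurable u : indicatorBV Omega u ->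
  exists2 v, measurable_fun setT v & {ae leb n, forall x, (u \_ Omega) x = v x}.
Proof.
move=> [[v [iv _] uv] _]; exists (v \_ Omega).
  by apply/(measurable_restrictT _ mOmega)/measurable_EFinP; exact: measurable_int iv.
by apply: filterS uv => x uvx; rewrite !patchE; case: ifPn => // /set_mem; exact: uvx.
Qed.

Lemma energy_threshold_le u v : measurable_fun setT (u \_ Omega) ->
  (forall x, Omega x -> 0 <= u x <= 1) ->
  v \_ Omega = threshold u ->
  energy Omega C p tau v <= energy Omega C p tau u.
Proof.
move=> mu u01 vE; have [c Cc] := C0.
have [_ _ _ /bounded_set_coord[B B0 OB]] := bOmega.
pose a : R := (16 * tau)^-1.
have a0 : 0 < a by rewrite invr_gt0 mulr_gt0.
have [M1 wM1] := weight_le_gaussian B0 OB fC Cc p0 (ltW a0).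
have [M2 gM2] := heat_kernel_weight_le B fC Cc p0 tau0.
(* A single integrable majorant for both bounds; the absolute values make its constant nonnegative
   and at least [M1] and [M2]. *)
pose P (x : 'rV[R]_n) : R := (`|M1| + `|M2|) * gaussian a x.
have iP : (leb n).-integrable setT (EFin \o P).
  have := integrableZl measurableT (`|M1| + `|M2|) (integrable_gaussian_rV n a0).
  by rewrite (_ : (fun _ => _) = EFin \o P).
have P0 x : 0 <= P x by rewrite mulr_ge0 ?addr_ge0 ?expR_ge0.
have w0 (x : 'rV[R]_n) : 0 <= weight C p x by exact: powR_ge0.
have g0 (x : 'rV[R]_n) : 0 <= heat_kernel tau x.
  by rewrite mulr_ge0 ?expR_ge0// invr_ge0 powR_ge0.
have wP x : Omega x -> `|weight C p x| <= P x.
  move=> Ox; rewrite ger0_norm// (le_trans (wM1 x Ox))// ler_wpM2r ?expR_ge0//.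
  by rewrite (le_trans (ler_norm _))// lerDl.
have gP x y : Omega x -> `|heat_kernel tau (x - y) * weight C p y| <= P y.
  move=> Ox; rewrite ger0_norm; last exact: mulr_ge0 (g0 _) (w0 _).
  apply: (le_trans (gM2 x y (OB x Ox))).
  by rewrite ler_wpM2r ?expR_ge0// (le_trans (ler_norm _))// lerDr.
have out f x : ~ Omega x -> (f \_ Omega) x = 0 :> R.
  by move=> nO; rewrite patchE memNset.
have mt : measurable_fun setT (v \_ Omega).
  by rewrite vE; apply: measurable_threshold mu _; exact: aeW.
have U01 x : 0 <= (u \_ Omega) x <= 1.
  by rewrite patchE; case: ifPn => [/set_mem/u01//|_]; rewrite lexx ler01.
have V01 x : 0 <= (v \_ Omega) x <= 1.
  rewrite vE /threshold patchE; case: ifPn => _; last by rewrite lexx ler01.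
  by case: ifP => _; rewrite !lexx ler01.
rewrite /energy ler_wpM2l ?sqrtr_ge0//.
apply: (threshold_energy_le (D := Omega) (P := P)
  (g := fun z => heat_kernel tau (z.1 - z.2))) => //.
- by move=> x y; exact: heat_kernel_sym.
- exact: out.
- exact: out.
(* The inner integral is the phase by conversion. Where it is [<= 0], [v = 1 >= u]; elsewhere on
   [Omega], [v = 0 <= u]. The product is nonpositive either way. *)
- move=> x; rewrite -[\int[_]_y _]/(phase Omega C p tau u x).
  have [Ox|nOx] := pselect (Omega x); last by rewrite !out// subr0 mulr0 mul0r.
  have {}U01 := U01 x; rewrite vE {1}/threshold patchE mem_set//.
  rewrite -mulrA mulr_ge0_le0//; case: ifPn => [ph|]; last rewrite -ltNge => ph.
    by rewrite mulr_ge0_le0// subr_ge0; case/andP: U01.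
  by rewrite mulr_le0_ge0 ?(ltW ph)// sub0r oppr_le0; case/andP: U01.
- apply: (heat_kernel_psd mOmega B0 OB tau0
    (f := fun x => weight C p x * ((v \_ Omega) x - (u \_ Omega) x))).
    apply: integrable_dominated iP _ => [|x].
      by apply: measurable_funM => //; exact: measurable_funB.
    have [Ox|nOx] := pselect (Omega x); last by rewrite !out// subrr mulr0 normr0.
    rewrite normrM (le_trans _ (wP x Ox))// ler_piMr// ler_norml.
    by move: (U01 x) (V01 x); lra.
  by move=> x nOx; rewrite !out// subrr mulr0.
Qed.

End thresholding.
Unset Implicit Arguments.

Theorem theorem2p4 (R : realType) (n : nat) (p tau : R)
    (Omega C : set 'rV[R]_n) (u : nat -> 'rV[R]_n -> R) :
  (0 < n)%N -> 0 < p -> 0 < tau ->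
  bounded_domain Omega ->
  finite_set C -> C !=set0 ->
  indicatorBV Omega (u 0%N) ->
  (forall k x, Omega x ->
     u k.+1 x = if phase Omega C p tau (u k) x <= 0 then 1 else 0) ->
  forall k, (1 <= k)%N ->
    energy Omega C p tau (u k.+1) <= energy Omega C p tau (u k).
Proof.
move=> _ p0 tau0 bO fC C0 u0 uS.
have uE k : u k.+1 \_ Omega = threshold p tau Omega C (u k).
  apply/funext => x; rewrite /threshold !patchE.
  by case: ifPn => // /set_mem; exact: uS.
(* Borel measurability starts at index [1]: the base case thresholds [u 0] through an almost
   everywhere equal Borel function. *)
have mu k : measurable_fun setT (u k.+1 \_ Omega).
  elim: k => [|k IH]; rewrite uE.
    have [v mv uv] := indicatorBV_ae_measurable bO u0.
    exact: measurable_threshold uv.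
  by apply: measurable_threshold IH _ => //; exact: aeW.
(* As [1 <= k], the current iterate is itself a threshold, hence Borel once extended and with values
   [0] and [1] on [Omega]. *)
case=> // k _; apply: energy_threshold_le => // x Ox.
by rewrite uS//; case: ifP => _; rewrite !lexx ler01.
Qed.
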